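(* Let $(H_m)_{m\in\mathbb{N}}$ be a sequence of hyperplanes in $\mathbb{R}^n$ with corresponding unit normals $(u_m)\subset\mathbb{S}^{n-1}$ (so $H_m=u_m^\perp$), and let $\diamondsuit\in\mathcal{F}$. If the angles $(\alpha_m)\subset[0,\pi/2]$ given by the relation $|u_m\cdot u_{m-1}|=\cos\alpha_m$ satisfy $$\sum_{m\in\mathbb{N}}|\alpha_m|<+\infty,$$ then the sequence $(H_m)$ converges and it is $\diamondsuit$-stable on $\mathcal{K}^n$.
   Context: $\mathcal{K}^n$ is the family of nonempty compact convex subsets of $\mathbb{R}^n$, equipped with the Hausdorff distance; convergence of sets is in this distance. ''Subspace'' means linear subspace of dimension $i$ with $1\le i\le n-1$; a hyperplane is a subspace of dimension $n-1$. Convergence of hyperplanes is in the usual topology of the Grassmannian of $(n-1)$-dimensional linear subspaces. The angles $\alpha_m$ are defined for those $m$ for which both $u_m$ and $u_{m-1}$ are terms of the sequence. For a subspace $H$, $H^\perp$ is its orthogonal complement, $P_{H^\perp}$ is orthogonal projection onto $H^\perp$, and $R_H(x)=x-2P_{H^\perp}x$ is the reflection with respect to $H$. An $H$-symmetrization on $\mathcal{K}^n$ is a map $\diamondsuit_H:\mathcal{K}^n\to\{K\in\mathcal{K}^n: R_HK=K\}$. A symmetrization $\diamondsuit$ on $\mathcal{K}^n$ assigns to every subspace $H$ an $H$-symmetrization $\diamondsuit_H$. $\mathcal{F}$ is the family of all symmetrizations $\diamondsuit$ on $\mathcal{K}^n$ such that for every subspace $H$: (monotonicity) $K\subseteq L$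 implies $\diamondsuit_HK\subseteq\diamondsuit_HL$ for all $K,L\in\mathcal{K}^n$; ($H^\perp$-translation invariance for $H$-symmetric sets) if $K\in\mathcal{K}^n$ and $R_HK=K$, then $\diamondsuit_H(K+x)=K$ for every $x\in H^\perp$; (invariance for $H$-symmetric sets) if $K\in\mathcal{K}^n$ and $R_HK=K$, then $\diamondsuit_HK=K$. A sequence of subspaces $(H_m)$ is $\diamondsuit$-stable on $\mathcal{K}^n$ if for every $k\in\mathbb{N}$ and every $K\in\mathcal{K}^n$ the sequence $\diamondsuit_{H_m}\cdots\diamondsuit_{H_{k+1}}\diamondsuit_{H_k}K$, $m\ge k$, converges (the limit may depend on $K$ and $k$). *)

(* Defs.v *)
From HB Require Import structures.
From mathcomp Require Import all_boot all_order all_algebra.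
From mathcomp Require Import all_classical all_reals all_analysis.
Import Order.TTheory GRing.Theory Num.Theory.
Import numFieldNormedType.Exports.

Set Implicit Arguments.
Unset Strict Implicit.
Unset Printing Implicit Defensive.

Local Open Scope classical_set_scope.
Local Open Scope ring_scope.

Definition dotv (R : realType) (n : nat) (u v : 'rV[R]_n) : R :=
  \sum_(i < n) u 0 i * v 0 i.

Section DotForm.
Variables (R : realType) (n : nat).

Fact dotv_is_bilinear : bilinear_for
  (GRing.Scale.Law.clone _ _ *%R _)
  (GRing.Scale.Law.clone _ _ (idfun \; *%R) _) (@dotv R n).
Proof.
split=> [v|u] a x y; rewrite /dotv /= mulr_sumr -big_split /=;
  apply: eq_bigr => i _; rewrite !mxE.
- by rewrite mulrDl mulrA.
- by rewrite mulrDr mulrCA.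
Qed.

HB.instance Definition _ := bilinear_isBilinear.Build R 'rV[R]_n 'rV[R]_n R
  (GRing.Scale.Law.clone _ _ *%R _)
  (GRing.Scale.Law.clone _ _ (idfun \; *%R) _) (@dotv R n) dotv_is_bilinear.

Fact dotv_is_symmetric (u v : 'rV[R]_n) :
  dotv u v = (-1) ^+ false * idfun (dotv v u).
Proof. by rewrite mul1r; apply: eq_bigr => i _; rewrite mulrC. Qed.

HB.instance Definition _ := isHermitianSesquilinear.Build R 'rV[R]_n
  false idfun (@dotv R n) dotv_is_symmetric.

Fact dotv_posdef (u : 'rV[R]_n) : u != 0 -> 0 < dotv u u.
Proof.
move=> /eqP u0; rewrite lt0r sumr_ge0 ?andbT; last first.
  by move=> i _; rewrite -expr2 sqr_ge0.
apply/eqP => /eqP; rewrite psumr_eq0; last first.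
  by move=> i _; rewrite -expr2 sqr_ge0.
move=> /allP d0; apply: u0; apply/rowP => i; rewrite mxE.
by have := d0 i (mem_index_enum i); rewrite /= mulf_eq0 orbb => /eqP.
Qed.

HB.instance Definition _ := isDotProduct.Build R 'rV[R]_n (@dotv R n)
  dotv_posdef.

End DotForm.

(* Euclidean norm; the library's norm `|u| on 'rV[R]_n is the sup norm. It
   induces the same topology, so [compact] below is unambiguous. *)
Definition enorm (R : realType) (n : nat) (u : 'rV[R]_n) : R :=
  Num.sqrt (dotv u u).

Definition orthc (R : realType) (n : nat) (H : {vspace 'rV[R]_n}) :
  {vspace 'rV[R]_n} := orthov (@dotv R n) H.

(* [daddv_pi U V] is the projection onto U along V. *)
Definition oproj (R : realType) (n : nat) (H : {vspace 'rV[R]_n}) :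
  'End('rV[R]_n) := daddv_pi H (orthc H).

Definition reflection (R : realType) (n : nat) (H : {vspace 'rV[R]_n})
    (x : 'rV[R]_n) : 'rV[R]_n :=
  x - 2 *: oproj (orthc H) x.

Section OrthogonalComplement.
Variables (R : realType) (n : nat).
Implicit Types (H : {vspace 'rV[R]_n}) (x : 'rV[R]_n).

Lemma orthcP H x : reflect {in H, forall y, dotv x y = 0} (x \in orthc H).
Proof. exact: mem_orthovP. Qed.

Lemma capv_orthc H : (H :&: orthc H = 0)%VS.
Proof.
apply/eqP; rewrite -subv0; apply/subvP => x; rewrite memv_cap memv0.
move=> /andP[xH /orthcP/(_ x xH) xx0]; apply: contraTT isT => x0.
by have := dotv_posdef x0; rewrite xx0 ltxx.
Qed.

Lemma dim_orthc_ge H : (n <= \dim H + \dim (orthc H))%N.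
Proof.
rewrite /orthc /orthov; under eq_bigr do rewrite -orthov1E.
elim: (\dim H) (tval (vbasis H)) => [|d IHd] s.
  by rewrite big_ord0 dimvf dim_matrix mul1r.
rewrite big_ord_recr /=; set W := (\bigcap_(i < d) _)%VS.
have := leq_dim_orthov1 (@dotv R n) s`_d W.
have := IHd s; rewrite -/W; set a := \dim W; set c := \dim _ => h1 h2.
rewrite (leq_trans h1) // addSnnS leq_add2l.
by move: h2; case: (a) => // a' /=.
Qed.

Lemma addv_orthc H : (H + orthc H = fullv)%VS.
Proof.
apply/eqP; rewrite eqEdim subvf /= dimv_disjoint_sum ?capv_orthc //.
by rewrite dimvf dim_matrix mul1r dim_orthc_ge.
Qed.

Lemma oproj_mem H x : oproj H x \in H.
Proof. exact: memv_pi. Qed.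

Lemma oproj_orth H x : x - oproj H x \in orthc H.
Proof.
rewrite -{1}(daddv_pi_add (capv_orthc H) (w := x)) ?addv_orthc ?memvf //.
by rewrite addrC addKr memv_pi.
Qed.

End OrthogonalComplement.

Definition proper_subspace (R : realType) (n : nat) (H : {vspace 'rV[R]_n}) :
  Prop := (1 <= \dim H <= n.-1)%N.

Definition hyperplane (R : realType) (n : nat) (H : {vspace 'rV[R]_n}) :
  Prop := \dim H = n.-1.

Definition convex_body (R : realType) (n : nat) (K : set 'rV[R]_n) : Prop :=
  [/\ K !=set0, compact K & convex_set K].

(* inf {e >= 0 : K is in L + e B and L is in K + e B}, B the unit ball *)
Definition hausdorff_dist (R : realType) (n : nat) (K L : set 'rV[R]_n) : R :=
  inf [set e : R | [/\ 0 <= e,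
    forall x, K x -> exists2 y, L y & enorm (x - y) <= e &
    forall y, L y -> exists2 x, K x & enorm (y - x) <= e]].

Definition body_cvg_to (R : realType) (n : nat) (K : nat -> set 'rV[R]_n)
    (L : set 'rV[R]_n) : Prop :=
  hausdorff_dist (K m) L @[m --> \oo] --> (0 : R).

(* The usual topology of a Grassmannian is the one of the metric given by the
   operator norm of the difference of the orthogonal projections. *)
Definition grassmann_dist (R : realType) (n : nat) (H H' : {vspace 'rV[R]_n}) :
  R := sup [set enorm (oproj H x - oproj H' x) | x in [set x | enorm x <= 1]].

Definition hyperplane_cvg (R : realType) (n : nat)
    (H : nat -> {vspace 'rV[R]_n}) : Prop :=
  exists2 H0 : {vspace 'rV[R]_n}, hyperplane H0 &
    grassmann_dist (H m) H0 @[m --> \oo] --> (0 : R).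

Definition symmetric_wrt (R : realType) (n : nat) (H : {vspace 'rV[R]_n})
    (K : set 'rV[R]_n) : Prop := reflection H @` K = K.

(* Maps between convex bodies are represented by maps on all sets; only their
   values at convex bodies (and at proper subspaces) matter. *)
Definition H_symmetrization (R : realType) (n : nat) (H : {vspace 'rV[R]_n})
    (f : set 'rV[R]_n -> set 'rV[R]_n) : Prop :=
  forall K, convex_body K -> convex_body (f K) /\ symmetric_wrt H (f K).

Definition symmetrization (R : realType) (n : nat)
    (D : {vspace 'rV[R]_n} -> set 'rV[R]_n -> set 'rV[R]_n) : Prop :=
  forall H, proper_subspace H -> H_symmetrization H (D H).

Definition sym_monotone (R : realType) (n : nat)
    (f : set 'rV[R]_n -> set 'rV[R]_n) : Prop :=
  forall K L, convex_body K -> convex_body L -> K `<=` L -> f K `<=` f L.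

Definition sym_translation_invariant (R : realType) (n : nat)
    (H : {vspace 'rV[R]_n}) (f : set 'rV[R]_n -> set 'rV[R]_n) : Prop :=
  forall K, convex_body K -> symmetric_wrt H K ->
  forall x, x \in orthc H -> f [set y + x | y in K] = K.

Definition sym_invariant (R : realType) (n : nat)
    (H : {vspace 'rV[R]_n}) (f : set 'rV[R]_n -> set 'rV[R]_n) : Prop :=
  forall K, convex_body K -> symmetric_wrt H K -> f K = K.

Definition family_F (R : realType) (n : nat)
    (D : {vspace 'rV[R]_n} -> set 'rV[R]_n -> set 'rV[R]_n) : Prop :=
  symmetrization D /\
  forall H, proper_subspace H ->
    [/\ sym_monotone (D H), sym_translation_invariant H (D H) &
        sym_invariant H (D H)].

(* [iter_sym D H k j K] is D_{H_(k+j)} ... D_{H_(k+1)} D_{H_k} K. *)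
Fixpoint iter_sym (R : realType) (n : nat)
    (D : {vspace 'rV[R]_n} -> set 'rV[R]_n -> set 'rV[R]_n)
    (H : nat -> {vspace 'rV[R]_n}) (k j : nat) (K : set 'rV[R]_n) :
    set 'rV[R]_n :=
  match j with
  | 0%N => D (H k) K
  | j'.+1 => D (H (k + j'.+1)%N) (iter_sym D H k j' K)
  end.

Definition stable (R : realType) (n : nat)
    (D : {vspace 'rV[R]_n} -> set 'rV[R]_n -> set 'rV[R]_n)
    (H : nat -> {vspace 'rV[R]_n}) : Prop :=
  forall (k : nat) (K : set 'rV[R]_n), convex_body K ->
  exists2 L, convex_body L & body_cvg_to (fun j => iter_sym D H k j K) L.

(* Main.v *)
Require Import Defs.
From mathcomp Require Import all_boot all_order all_algebra.
From mathcomp Require Import all_classical all_reals all_analysis.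
From mathcomp Require Import ring lra.
Import Order.TTheory GRing.Theory Num.Theory.
Import numFieldNormedType.Exports.

(** Convergence of the hyperplanes.  After replacing some [u m] by [- u m], which
    does not change the hyperplane, consecutive normals form the angle [alpha m]
    itself, so that they are at distance at most [alpha m]
    ([enorm_sub_le_angle]).  As the angles are summable, the new normals [v m]
    form a Cauchy sequence, and [v |-> orthc <[v]>] is Lipschitz on the unit
    sphere.

    Stability.  Let [L] be a convex body in the ball of radius [r], symmetric
    with respect to one hyperplane [H], and let [H'] be the next hyperplane.  The
    reflections in [H] and [H'] differ on [L] by at most [e], a constant times
    [alpha * r], so that the reflection in [H'] maps [L] into the [e]-thickening
    of [L].  Hence the points of the thickening whose reflection in [H'] also
    lies in the thickening form an [H']-symmetric convex body which contains [L].
    Invariance and monotonicity give that the symmetral of [L] with respect to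
    [H'] lies in the thickening ([symmetrization_sub_thicken]).

    This is a bound from one side only, and no such bound holds in the other
    direction: the Steiner symmetral, with respect to some [H'] other than [H],
    of a segment orthogonal to [H] is the projection of the segment onto [H'],
    whose length tends to [0] as [H'] tends to [H].  The one-sided bound
    suffices nevertheless.  If [K (j+1)] lies in the [(d j - d (j+1))]-thickening
    of [K j], with [d] decreasing to [0], then the [d j]-thickenings of the [K j]
    are nested compact sets, and both they and the [K j] converge to their
    intersection ([almost_decreasing_body_cvg]). *)

Set Implicit Arguments.
Unset Strict Implicit.
Unset Printing Implicit Defensive.

Local Open Scope classical_set_scope.
Local Open Scope ring_scope.

(** * The Euclidean norm *)

Section EuclideanNorm.
Variables (R : realType) (n : nat).
Implicit Types (u v w x y : 'rV[R]_n) (a : R).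

Lemma dotvC u v : dotv u v = dotv v u.
Proof. by apply: eq_bigr => i _; rewrite mulrC. Qed.

Lemma dotvDl u v w : dotv (u + v) w = dotv u w + dotv v w.
Proof.
by rewrite /dotv -big_split; apply: eq_bigr => i _; rewrite mxE mulrDl.
Qed.

Lemma dotvZl a u w : dotv (a *: u) w = a * dotv u w.
Proof. by rewrite /dotv mulr_sumr; apply: eq_bigr => i _; rewrite mxE mulrA. Qed.

Lemma dotvNl u w : dotv (- u) w = - dotv u w.
Proof. by rewrite -scaleN1r dotvZl mulN1r. Qed.

Lemma dotvDr u v w : dotv w (u + v) = dotv w u + dotv w v.
Proof. by rewrite !(dotvC w) dotvDl. Qed.

Lemma dotvZr a u w : dotv w (a *: u) = a * dotv w u.
Proof. by rewrite !(dotvC w) dotvZl. Qed.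

Lemma dotvNr u w : dotv w (- u) = - dotv w u.
Proof. by rewrite !(dotvC w) dotvNl. Qed.

Definition dotvE := (dotvDl, dotvDr, dotvZl, dotvZr, dotvNl, dotvNr).

Lemma dotv_ge0 u : 0 <= dotv u u.
Proof. by apply: sumr_ge0 => i _; rewrite -expr2 sqr_ge0. Qed.

Lemma enorm_ge0 u : 0 <= enorm u.
Proof. exact: sqrtr_ge0. Qed.

Lemma sqr_enorm u : enorm u ^+ 2 = dotv u u.
Proof. by rewrite sqr_sqrtr ?dotv_ge0. Qed.

Lemma enorm_eq0 u : enorm u = 0 -> u = 0.
Proof.
move=> u0; apply: contrapT => /eqP /dotv_posdef.
by rewrite -sqr_enorm u0 expr0n ltxx.
Qed.

Lemma enorm0 : enorm (0 : 'rV[R]_n) = 0.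
Proof. by rewrite /enorm -(scale0r 0) dotvZl mul0r sqrtr0. Qed.

Lemma enormZ a u : enorm (a *: u) = `|a| * enorm u.
Proof.
by rewrite /enorm !dotvE mulrA -expr2 sqrtrM ?sqr_ge0 // sqrtr_sqr.
Qed.

Lemma enormN u : enorm (- u) = enorm u.
Proof. by rewrite -scaleN1r enormZ normrN1 mul1r. Qed.

Lemma enormBC u v : enorm (u - v) = enorm (v - u).
Proof. by rewrite -enormN opprB. Qed.

Lemma cauchy_schwarz u v : `|dotv u v| <= enorm u * enorm v.
Proof.
have [/enorm_eq0 ->|u0] := eqVneq (enorm u) 0.
  by rewrite enorm0 mul0r -(scale0r u) dotvZl mul0r normr0.
have u_gt0 : 0 < enorm u by rewrite lt0r u0 enorm_ge0.
rewrite -ler_sqr ?nnegrE ?mulr_ge0 ?enorm_ge0 // real_normK ?num_real //.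
rewrite exprMn -(ler_pM2l (exprn_gt0 2 u_gt0)) sqr_enorm.
(* the component of v orthogonal to u, scaled by |u|^2 to avoid a division *)
have := dotv_ge0 (dotv u u *: v - dotv u v *: u).
rewrite !dotvE (dotvC v u) -!sqr_enorm; nra.
Qed.

Lemma enorm_triangle u v : enorm (u + v) <= enorm u + enorm v.
Proof.
rewrite -ler_sqr ?nnegrE ?addr_ge0 ?enorm_ge0 // sqr_enorm !dotvE.
have := le_trans (ler_norm _) (cauchy_schwarz u v).
rewrite (dotvC v u) sqrrD -!sqr_enorm; lra.
Qed.

Lemma enormB_triangle u v w : enorm (u - w) <= enorm (u - v) + enorm (v - w).
Proof. by apply: le_trans (enorm_triangle _ _); rewrite addrA subrK. Qed.

Lemma coord_le_enorm u i : `|u 0 i| <= enorm u.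
Proof.
rewrite -sqrtr_sqr ler_wsqrtr // /dotv (bigD1 i) //= -expr2 lerDl.
by apply: sumr_ge0 => j _; rewrite -expr2 sqr_ge0.
Qed.

(** Transfers boundedness and Cauchy estimates to the sup norm, which carries
    the topology. *)
Lemma norm_le_enorm u : `|u| <= enorm u.
Proof.
rewrite /Num.norm /= mx_normrE; apply/bigmax_leP; split; first exact: enorm_ge0.
by move=> [i j] _ /=; rewrite ord1 coord_le_enorm.
Qed.

Lemma enorm_continuous : continuous (@enorm R n).
Proof.
move=> x; apply: (@continuous_comp _ _ _ (fun u => dotv u u) Num.sqrt).
  apply: (@continuous_big _ _ _ _ _ _ _ _
    (fun i (u : 'rV[R]_n) => u 0 i * u 0 i)) => [|i _] u.
    exact: add_continuous.
  have c : v 0 i @[v --> u] --> u 0 i by exact: coord_continuous.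
  exact: (cvgM c c).
exact: sqrt_continuous.
Qed.

(** The topology is that of the sup norm; continuity of the Euclidean norm makes
    its open balls neighbourhoods. *)
Lemma enorm_small e : 0 < e -> forall x, \forall y \near x, enorm (x - y) < e.
Proof.
move=> e0 x.
have c : enorm (x - y) @[y --> x] --> enorm (x - x).
  apply: (@continuous_comp _ _ _ (fun y => x - y) (@enorm R n)).
    by apply: continuousB => //; exact: cst_continuous.
  exact: enorm_continuous.
rewrite subrr enorm0 in c.
exact: (c _ (lt_nbhsl e0)).
Qed.

End EuclideanNorm.

(** * Thickenings and Hausdorff convergence of convex bodies *)

Section Thickening.
Variables (R : realType) (n : nat).
Implicit Types (x y : 'rV[R]_n) (K L : set 'rV[R]_n) (d e r t : R).

Definition thicken K e : set 'rV[R]_n :=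
  [set x | exists2 y, K y & enorm (x - y) <= e].

Definition cball r : set 'rV[R]_n := [set x | enorm x <= r].

Lemma convex_setP K : convex_set K <->
  forall x y t, 0 <= t -> t <= 1 -> K x -> K y -> K (t *: x + (1 - t) *: y).
Proof.
split=> [cK x y t t0 t1 Kx Ky|cK x y t].
  by have := cK x y (Itv01 t0 t1); rewrite !inE; apply.
by rewrite !inE => Kx Ky; apply: cK; rewrite ?ge0 ?le1.
Qed.

Lemma enorm_conv x y t r : 0 <= t -> t <= 1 -> enorm x <= r -> enorm y <= r ->
  enorm (t *: x + (1 - t) *: y) <= r.
Proof.
move=> t0 t1 xr yr; apply: le_trans (enorm_triangle _ _) _.
rewrite !enormZ !ger0_norm ?subr_ge0 //; nra.
Qed.

Lemma convex_thicken K e : convex_set K -> convex_set (thicken K e).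
Proof.
move=> /convex_setP cK; apply/convex_setP => x y t t0 t1 [x' Kx' xx'] [y' Ky' yy'].
exists (t *: x' + (1 - t) *: y'); first exact: cK.
rewrite opprD addrACA -!scalerBr; exact: enorm_conv.
Qed.

Lemma compact_cball r : compact (cball r).
Proof.
apply: bounded_closed_compact.
  exists r; split; first exact: num_real.
  by move=> s rs x /= xr; apply: le_trans (norm_le_enorm x) (le_trans xr (ltW rs)).
apply: (preimage_closed _ (@closed_le _ r)) => x _.
exact: enorm_continuous.
Qed.

(** The Minkowski sum form, from which compactness follows. *)
Lemma thickenE K e : thicken K e = (fun p => p.1 + p.2) @` (K `*` cball e).
Proof.
apply/seteqP; split=> [x [y Ky xy]|_ [[y z] [/= Ky zr] <-]] /=.
  by exists (y, x - y) => //=; rewrite addrC subrK.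
by exists y => //; rewrite addrC addKr.
Qed.

Lemma compact_thicken K e : compact K -> compact (thicken K e).
Proof.
move=> cK; rewrite thickenE; apply: continuous_compact.
  by apply: continuous_subspaceT => x; apply: add_continuous.
by apply: compact_setX => //; apply: compact_cball.
Qed.

Lemma convex_body_cball r : 0 <= r -> convex_body (cball r).
Proof.
move=> r0; split; [|exact: compact_cball|].
  by exists 0; rewrite /cball /= enorm0.
by apply/convex_setP => x y t t0 t1 xr yr; apply: enorm_conv.
Qed.

Lemma sub_thicken K e : 0 <= e -> K `<=` thicken K e.
Proof. by move=> e0 x Kx; exists x => //; rewrite subrr enorm0. Qed.

Lemma convex_body_thicken K e : 0 <= e -> convex_body K ->
  convex_body (thicken K e).
Proof.
move=> e0 [[x Kx] cK vK]; split; [|exact: compact_thicken|exact: convex_thicken].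
by exists x; apply: sub_thicken.
Qed.

Lemma thicken_sub K L d e : K `<=` thicken L d ->
  thicken K e `<=` thicken L (d + e).
Proof.
move=> KL x [y /KL [z Lz yz] xy]; exists z => //.
by apply: le_trans (enormB_triangle x y z) _; rewrite addrC lerD.
Qed.

Lemma body_sub_cball K : convex_body K -> exists2 r, 0 <= r & K `<=` cball r.
Proof.
move=> [[x0 Kx0] cK _].
have cE : {within K, continuous (@enorm R n)}.
  by apply: continuous_subspaceT => x; apply: enorm_continuous.
have K0 : K !=set0 by exists x0.
have [z _ zmax] := compact_EVT_max K0 cK cE.
by exists (enorm z); [exact: enorm_ge0|move=> x /mem_set /zmax].
Qed.

Lemma closed_compact_rV K : compact K -> closed K.
Proof. by apply: compact_closed; apply: norm_hausdorff. Qed.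

Lemma nested_sub (A : nat -> set 'rV[R]_n) : (forall j, A j.+1 `<=` A j) ->
  forall i j, (i <= j)%N -> A j `<=` A i.
Proof.
move=> decA i j /subnK <-; elim: (j - i)%N => [//|k IH].
by rewrite addSn; apply: subset_trans (decA _) IH.
Qed.

(** A cluster point of the sequence [x] in [A 0] lies in every [A j] because the
    tails of [x] do.  This gives at once that the intersection is nonempty and
    that points of the [A j] cannot stay away from it. *)
Lemma nested_compact_cluster (A : nat -> set 'rV[R]_n) (x : nat -> 'rV[R]_n) :
    (forall j, compact (A j)) -> (forall j, A j.+1 `<=` A j) ->
    (forall j, A j (x j)) ->
  exists2 y, (forall j, A j y) &
    forall e N, 0 < e -> exists2 i, (N <= i)%N & enorm (x i - y) < e.
Proof.
move=> cA decA Ax.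
have subA := nested_sub decA.
have evA j : (x @ \oo) (A j).
  by exists j => // i /= ji; apply: (subA j i).
have [y [_ ycl]] := cA 0%N (x @ \oo) _ (evA 0%N).
exists y => [j|e N e0].
  apply: (closed_compact_rV (cA j)).
  by move=> B yB; have := ycl _ _ (evA j) yB.
have evN : (x @ \oo) (x @` [set i | (N <= i)%N]).
  by exists N => // i /= Ni; exists i.
have [_ [[i /= Ni <-] /= xiy]] := ycl _ _ evN (enorm_small e0 y).
by exists i; rewrite 1?enormBC.
Qed.

Lemma hausdorff_dist_le K L e : 0 <= e ->
  K `<=` thicken L e -> L `<=` thicken K e -> hausdorff_dist K L <= e.
Proof. by move=> e0 KL LK; apply: ge_inf; [exists 0 => d []|split]. Qed.

Lemma hausdorff_dist_ge0 K L : 0 <= hausdorff_dist K L.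
Proof.
rewrite /hausdorff_dist; set E := (X in inf X).
have [->|/set0P E0] := eqVneq E set0; first by rewrite inf0.
by apply: lb_le_inf => // e [].
Qed.

Lemma nonincreasing_cvg0_ge0 (d : nat -> R) :
  (forall j, d j.+1 <= d j) -> d @ \oo --> 0 -> forall j, 0 <= d j.
Proof.
move=> /nonincreasing_seqP decd d0 j.
by have := nonincreasing_cvgn_ge decd (cvgP _ d0) j; rewrite (cvg_lim _ d0).
Qed.

(** The [d j]-thickenings [A j] of the [K j] are nested; [K j] is in [A j], and by
    compactness [A j] is eventually in any thickening of the intersection [L];
    conversely [L] is in [A j], so within [d j] of [K j]. *)
Lemma almost_decreasing_body_cvg (K : nat -> set 'rV[R]_n) (d : nat -> R) :
    (forall j, convex_body (K j)) ->
    (forall j, d j.+1 <= d j) -> d @ \oo --> 0 ->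
    (forall j, K j.+1 `<=` thicken (K j) (d j - d j.+1)) ->
  exists2 L, convex_body L & body_cvg_to K L.
Proof.
move=> bodyK decd d0 KS.
have d_ge0 := nonincreasing_cvg0_ge0 decd d0.
pose A j := thicken (K j) (d j).
have bodyA j : convex_body (A j) by apply: convex_body_thicken.
have cA j : compact (A j) by have [] := bodyA j.
have decA j : A j.+1 `<=` A j.
  by move=> x /(thicken_sub (KS j)); rewrite subrK.
pose L := \bigcap_j A j.
have KA j : K j `<=` A j by apply: sub_thicken.
have LA j : L `<=` A j by move=> x; apply.
have bodyL : convex_body L.
  split.
  - have [x Kx] : {x : nat -> 'rV[R]_n & forall j, K j (x j)}.
      by apply: choice => j; have [] := bodyK j.
    have [y Ay _] := nested_compact_cluster cA decA (fun j => KA j _ (Kx j)).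
    by exists y => j _.
  - apply: (subclosed_compact _ (cA 0%N) (LA 0%N)).
    by apply: closed_bigI => j _; apply: closed_compact_rV.
  - apply/convex_setP => x y t t0 t1 Lx Ly j _.
    have [_ _ /convex_setP cvA] := bodyA j.
    exact: (cvA _ _ _ t0 t1 (LA j _ Lx) (LA j _ Ly)).
exists L => //.
have subA := nested_sub decA.
have evL e : 0 < e -> \forall j \near \oo, K j `<=` thicken L e.
  move=> e0; suff [N ANL] : exists N, A N `<=` thicken L e.
    exists N => // j /= Nj.
    exact: subset_trans (KA j) (subset_trans (subA _ _ Nj) ANL).
  apply: contrapT => /forallNP nAL.
  have [x Ax] : {x : nat -> 'rV[R]_n & forall j, A j (x j) /\ ~ thicken L e (x j)}.
    apply: (@choice _ _ (fun j y => A j y /\ ~ thicken L e y)) => j.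
    by have /existsNP[x /not_implyP] := nAL j; exists x.
  have [y Ay ylim] := nested_compact_cluster cA decA (fun j => (Ax j).1).
  have [i _ xiy] := ylim e 0%N e0.
  by apply: (Ax i).2; exists y; [move=> j _|exact: ltW].
apply/cvgrPdist_le => e e0.
near=> j.
rewrite sub0r normrN ger0_norm ?hausdorff_dist_ge0 //.
apply: hausdorff_dist_le; first exact: ltW.
  by near: j; apply: evL.
move=> x /(LA j) [y Ky xy]; exists y => //; apply: le_trans xy _.
near: j; move/cvgrPdist_le: d0 => /(_ e e0); apply: filterS => j.
by rewrite sub0r normrN ger0_norm.
Unshelve. all: by end_near.
Qed.

End Thickening.

(** * Reflections in nearby hyperplanes *)

Section Hyperplanes.
Variables (R : realType) (n : nat).
Implicit Types (v w x y : 'rV[R]_n) (a : R) (H : {vspace 'rV[R]_n}).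

Lemma oproj_unique H x y : y \in H -> x - y \in orthc H -> oproj H x = y.
Proof.
move=> yH xy; apply/eqP; rewrite -subr_eq0 -memv0 -(capv_orthc H) memv_cap.
rewrite rpredB ?oproj_mem //=.
have -> : oproj H x - y = (x - y) - (x - oproj H x).
  by rewrite opprB [RHS]addrC addrA subrK.
by rewrite rpredB ?oproj_orth.
Qed.

Lemma mem_orthc_line v x : (x \in orthc <[v]>%VS) = (dotv x v == 0).
Proof. exact: mem_orthov1. Qed.

Lemma sub_orthcK H x : x \in H -> x \in orthc (orthc H).
Proof. by move=> xH; apply/orthcP => y /orthcP/(_ x xH) <-; rewrite dotvC. Qed.

Lemma orthc_lineZ a v : a != 0 -> orthc <[a *: v]>%VS = orthc <[v]>%VS.
Proof.
move=> a0; apply/vspaceP => x.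
by rewrite !mem_orthc_line dotvZr mulf_eq0 (negPf a0).
Qed.

Lemma dotv_unit v : enorm v = 1 -> dotv v v = 1.
Proof. by move=> v1; rewrite -sqr_enorm v1 expr1n. Qed.

Lemma oproj_hyperplane v x : enorm v = 1 ->
  oproj (orthc <[v]>%VS) x = x - dotv x v *: v.
Proof.
move=> v1; apply: oproj_unique.
  by rewrite mem_orthc_line !dotvE (dotv_unit v1) mulr1 subrr.
by rewrite opprB addrC subrK; apply: sub_orthcK; rewrite memvZ ?memv_line.
Qed.

Lemma reflection_hyperplane v x : enorm v = 1 ->
  reflection (orthc <[v]>%VS) x = x - 2 *: (dotv x v *: v).
Proof.
move=> v1; rewrite /reflection (@oproj_unique _ _ (dotv x v *: v)) //.
  by apply: sub_orthcK; rewrite memvZ ?memv_line.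
by apply: sub_orthcK; rewrite mem_orthc_line !dotvE (dotv_unit v1) mulr1 subrr.
Qed.

Lemma hyperplane_orthc_line v : enorm v = 1 -> hyperplane (orthc <[v]>%VS).
Proof.
move=> v1; rewrite /hyperplane.
have := dimv_disjoint_sum (capv_orthc <[v]>%VS).
rewrite addv_orthc dimvf dim_matrix mul1r dim_vline.
have -> : v != 0 by apply: contra_eq_neq v1 => ->; rewrite enorm0 eq_sym oner_eq0.
by move=> /(congr1 predn) /=; rewrite add0n => <-.
Qed.

(** Both the difference of the projections and half that of the reflections are
    of this rank one form, up to sign. *)
Lemma rank1_dist v w x : enorm v = 1 -> enorm w = 1 ->
  enorm (dotv x v *: v - dotv x w *: w) <= 2 * enorm (v - w) * enorm x.
Proof.
move=> v1 w1.
have -> : dotv x v *: v - dotv x w *: w =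
    dotv x v *: (v - w) + dotv x (v - w) *: w.
  by rewrite dotvDr dotvNr scalerDl scalerBr scaleNr addrA subrK.
apply: le_trans (enorm_triangle _ _) _; rewrite !enormZ w1 mulr1.
have := cauchy_schwarz x (v - w).
have := ler_wpM2r (enorm_ge0 (v - w)) (cauchy_schwarz x v).
rewrite v1; lra.
Qed.

Lemma reflection_dist v w x : enorm v = 1 -> enorm w = 1 ->
  enorm (reflection (orthc <[v]>%VS) x - reflection (orthc <[w]>%VS) x)
    <= 4 * enorm (v - w) * enorm x.
Proof.
move=> v1 w1; rewrite !reflection_hyperplane //.
rewrite opprB addrC addrA subrK -scalerBr enormZ normr_nat.
by have := rank1_dist x v1 w1; rewrite (enormBC (_ *: v)); lra.
Qed.

Lemma grassmann_dist_le v w : enorm v = 1 -> enorm w = 1 ->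
  grassmann_dist (orthc <[v]>%VS) (orthc <[w]>%VS) <= 2 * enorm (v - w).
Proof.
move=> v1 w1; apply: ge_sup.
  by exists (enorm (oproj (orthc <[v]>%VS) 0 - oproj (orthc <[w]>%VS) 0)), 0;
    rewrite //= enorm0.
move=> _ [x /= x1 <-]; rewrite !oproj_hyperplane //.
rewrite opprB addrC addrA subrK (enormBC (_ *: w)).
apply: le_trans (rank1_dist x v1 w1) _.
by rewrite ler_piMr // mulr_ge0 // enorm_ge0.
Qed.

Lemma grassmann_dist_ge0 H H' : 0 <= grassmann_dist H H'.
Proof.
rewrite /grassmann_dist; set E := (X in sup X).
have [supE|/sup_out ->//] := pselect (has_sup E).
apply: ub_le_sup; first by case: supE.
by exists 0; rewrite /= ?enorm0 // !linear0 addr0 enorm0.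
Qed.

Lemma reflectionK v : enorm v = 1 -> involutive (reflection (orthc <[v]>%VS)).
Proof.
move=> v1 x; rewrite !reflection_hyperplane // !dotvE (dotv_unit v1) mulr1.
rewrite !scalerA -addrA -opprD -scalerDl.
have -> : 2 * dotv x v + 2 * (dotv x v - 2 * dotv x v) = 0 by ring.
by rewrite scale0r subr0.
Qed.

Lemma enorm_reflection v x : enorm v = 1 ->
  enorm (reflection (orthc <[v]>%VS) x) = enorm x.
Proof.
move=> v1; rewrite reflection_hyperplane // /enorm; congr Num.sqrt.
by rewrite !dotvE (dotv_unit v1) (dotvC v x); ring.
Qed.

Lemma reflection_conv v x y t :
  reflection (orthc <[v]>%VS) (t *: x + (1 - t) *: y) =
  t *: reflection (orthc <[v]>%VS) x + (1 - t) *: reflection (orthc <[v]>%VS) y.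
Proof.
rewrite /reflection; set P := oproj _.
have -> : P (t *: x + (1 - t) *: y) = t *: P x + (1 - t) *: P y.
  by rewrite linearD !linearZ.
rewrite (scalerDr 2) opprD addrACA !scalerBr.
by rewrite !scalerA ![2 * _]mulrC.
Qed.

Lemma dotv_continuous w : continuous (fun x => dotv x w).
Proof.
apply: (@continuous_big _ _ _ _ _ _ _ _
  (fun i (u : 'rV[R]_n) => u 0 i * w 0 i)) => [|i _] u.
  exact: add_continuous.
have c : v 0 i @[v --> u] --> u 0 i by exact: coord_continuous.
exact: (cvgMl c).
Qed.

Lemma reflection_continuous v : enorm v = 1 ->
  continuous (reflection (orthc <[v]>%VS)).
Proof.
move=> v1; rewrite (funext (fun x => reflection_hyperplane x v1)) => x.
have cvg_refl (F : set_system 'rV[R]_n) : Filter F -> F --> x ->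
    dotv y v @[y --> F] --> dotv x v ->
    y - 2 *: (dotv y v *: v) @[y --> F] --> x - 2 *: (dotv x v *: v).
  by move=> FF Fx c; apply: (cvgB Fx); apply: cvgZl_tmp; apply: cvgZr_tmp.
exact: (cvg_refl (nbhs x) (nbhs_filter x) cvg_id (@dotv_continuous v x)).
Qed.

Lemma symmetric_cball v r : enorm v = 1 ->
  symmetric_wrt (orthc <[v]>%VS) (cball r).
Proof.
move=> v1; apply/seteqP; split=> [_ [x /= xr <-]|x /= xr].
  by rewrite /cball /= enorm_reflection.
exists (reflection (orthc <[v]>%VS) x); last exact: reflectionK.
by rewrite /cball /= enorm_reflection.
Qed.

(** The body [M] of the points [x] such that both [x] and its reflection lie in
    the thickening is reflection invariant since the reflection is an involution;
    it contains [L] since on [L] the new reflection is close to the old one, which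
    preserves [L]. *)
Lemma symmetrization_sub_thicken v w
    (f : set 'rV[R]_n -> set 'rV[R]_n) (L : set 'rV[R]_n) r :
    enorm v = 1 -> enorm w = 1 -> 0 <= r ->
    sym_monotone f -> sym_invariant (orthc <[w]>%VS) f ->
    convex_body L -> symmetric_wrt (orthc <[v]>%VS) L -> L `<=` cball r ->
  f L `<=` thicken L (4 * enorm (v - w) * r).
Proof.
move=> v1 w1 r0 fmono finv bodyL symL Lr.
set e := (X in thicken L X); set refl := reflection (orthc <[w]>%VS).
have e0 : 0 <= e by rewrite !mulr_ge0 ?enorm_ge0.
pose M := thicken L e `&` refl @^-1` thicken L e.
have [[x0 Lx0] cL vL] := bodyL.
have LM : L `<=` M.
  move=> x Lx; split; first exact: sub_thicken.
  exists (reflection (orthc <[v]>%VS) x); first by rewrite -symL; exists x.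
  apply: le_trans (reflection_dist x w1 v1) _; rewrite enormBC.
  by rewrite ler_wpM2l ?mulr_ge0 ?enorm_ge0 //; apply: Lr.
have bodyM : convex_body M.
  have cT := compact_thicken (e := e) cL.
  split; first by exists x0; apply: LM.
  - apply: (subclosed_compact _ cT) => [|x []//].
    apply: closedI; first exact: closed_compact_rV.
    apply: preimage_closed (closed_compact_rV cT) => x _.
    exact: reflection_continuous.
  - have /convex_setP vT := convex_thicken (e := e) vL.
    apply/convex_setP => x y t t0 t1 [Tx Trx] [Ty Try].
    split; first exact: vT.
    by rewrite /preimage /= /refl reflection_conv; apply: vT.
have symM : symmetric_wrt (orthc <[w]>%VS) M.
  have reflM x : M x -> M (refl x).
    by case=> Tx Trx; split; rewrite // /preimage /= /refl reflectionK.
  apply/seteqP; split=> [_ [x Mx <-]|x Mx]; first exact: reflM.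
  by exists (refl x); [exact: reflM|exact: reflectionK].
by move=> x /(fmono _ _ bodyL bodyM LM); rewrite finv // => -[].
Qed.

End Hyperplanes.

(** * Unit normals with summable angles *)

Section Normals.
Variables (R : realType) (n : nat).
Implicit Types (u v : nat -> 'rV[R]_n) (d : nat -> R) (a : R).

(** The mean value theorem bounds [sin a] by [a]. *)
Lemma sqr_sin_le a : 0 <= a -> sin a ^+ 2 <= a ^+ 2.
Proof.
move=> a0.
have [c _] : exists2 c, c \in `[0, a]%R & sin a - sin 0 = cos c * (a - 0).
  apply: MVT_segment => //.
  by apply: continuous_subspaceT => x; apply: continuous_sin.
by rewrite sin0 !subr0 => ->; rewrite exprMn ler_piMl ?sqr_ge0.
Qed.

(** The chord [2 * sin (a / 2)] is at most the arc [a]. *)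
Lemma enorm_sub_le_angle (v w : 'rV[R]_n) a : enorm v = 1 -> enorm w = 1 ->
  0 <= a -> dotv v w = cos a -> enorm (v - w) <= a.
Proof.
move=> v1 w1 a0 vw; rewrite -ler_sqr ?nnegrE ?enorm_ge0 // sqr_enorm.
rewrite !dotvE (dotvC w v) (dotv_unit v1) (dotv_unit w1) vw.
have h0 : 0 <= a / 2 by rewrite divr_ge0.
have {1 2}-> : a = (a / 2) *+ 2 by rewrite mulr2n -splitr.
rewrite cos_mulr2n; have := sqr_sin_le h0; rewrite sin2cos2; nra.
Qed.

(** Flipping the signs successively makes the product of each normal with its
    predecessor nonnegative; the sign of the m-th normal is the product of the
    flips. *)
Lemma aligned_multiples u : exists s : nat -> R, forall m,
  `|s m| = 1 /\
  dotv (s m.+1 *: u m.+1) (s m *: u m) = `|dotv (u m.+1) (u m)|.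
Proof.
pose c i : R := (-1) ^+ (dotv (u i.+1) (u i) < 0)%R.
have s1 m : `|\prod_(i < m) c i| = 1.
  by rewrite normr_prod big1 // => i _; rewrite normrX normrN1 expr1n.
exists (fun m => \prod_(i < m) c i) => m; split=> //.
rewrite big_ord_recr /= !dotvE normrEsign -/(c m).
have := real_normK (num_real (\prod_(i < m) c i)); rewrite s1 expr1n => ss.
by rewrite mulrCA !mulrA -expr2 -ss mul1r.
Qed.

(** The tails of the series: a null sequence whose decrements are the terms. *)
Lemma summable_tails (b : nat -> R) : (forall m, 0 <= b m) ->
  (\sum_(1 <= m <oo) (b m)%:E < +oo)%E ->
  exists2 d : nat -> R, d @ \oo --> 0 & forall m, d m - d m.+1 = b m.+1.
Proof.
move=> b0 sumb.
pose S k := \sum_(1 <= i < k) b i.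
have cS : cvgn (fun k => \sum_(1 <= i < k) (b i)%:E)%E.
  by apply: is_cvg_nneseries => i _ _; rewrite lee_fin.
set l := (X in (X < +oo)%E) in sumb.
have lfin : l \is a fin_num.
  by rewrite ge0_fin_numE //; apply: nneseries_ge0 => i _ _; rewrite lee_fin.
have Sl : S @ \oo --> fine l.
  have -> : S = fine \o (fun k => \sum_(1 <= i < k) (b i)%:E)%E.
    by apply/funext => k /=; rewrite sumEFin.
  by apply: fine_cvg; rewrite fineK.
exists (fun m => fine l - S m.+1) => [|m].
  rewrite -(subrr (fine l)); apply: cvgB; first exact: cvg_cst.
  by rewrite (cvg_shiftS S).
have -> : S m.+2 = S m.+1 + b m.+1 by rewrite /S big_nat_recr.
by ring.
Qed.

(** Telescoping the hypothesis shows that the sequence is Cauchy; the bound on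
    the distance to the limit is the limit of the telescoped bound. *)
Lemma cvg_of_summable_steps v d : d @ \oo --> 0 ->
    (forall m, enorm (v m - v m.+1) <= d m - d m.+1) ->
  exists w, forall m, enorm (v m - w) <= d m.
Proof.
move=> d0 vd.
have vd_le i j : (i <= j)%N -> enorm (v i - v j) <= d i - d j.
  move=> /subnK <-; elim: (j - i)%N => [|k IH].
    by rewrite add0n !subrr enorm0.
  rewrite addSn; apply: le_trans (enormB_triangle _ (v (k + i)%N) _) _.
  by have := vd (k + i)%N; lra.
have decd j : d j.+1 <= d j.
  by rewrite -subr_ge0; exact: le_trans (enorm_ge0 _) (vd j).
have d_ge0 := nonincreasing_cvg0_ge0 decd d0.
have /cauchy_cvgP/cvg_ex[w vw] : cauchy (v @ \oo).
  apply: cauchy_exP => e e0.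
  have [N _ dN] : \forall m \near \oo, d m < e.
    by apply: (cvgr_lt 0 d0).
  exists (v N), N => // j /= Nj; rewrite -ball_normE /=.
  apply: le_lt_trans (norm_le_enorm _) _; apply: le_lt_trans (vd_le _ _ Nj) _.
  by have /= := dN N (leqnn N); have := d_ge0 j; lra.
exists w => m; apply/ler_addgt0Pr => e e0.
have [N _ vN] : \forall j \near \oo, enorm (w - v j) < e.
  exact: vw _ (enorm_small e0 w).
have mj := leq_maxl m N; have Nj := leq_maxr m N; set j := maxn m N in mj Nj.
apply: le_trans (enormB_triangle _ (v j) _) _.
have /= := vN j Nj; rewrite (enormBC w) => vjw.
by have := vd_le m j mj; have := d_ge0 j; lra.
Qed.

Lemma unit_of_limit v d (w : 'rV[R]_n) : (forall m, enorm (v m) = 1) ->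
  d @ \oo --> 0 -> (forall m, enorm (v m - w) <= d m) -> enorm w = 1.
Proof.
move=> v1 d0 vw; apply/eqP; rewrite eq_le; apply/andP.
suff near1 e : 0 < e -> enorm w <= 1 + e /\ 1 <= enorm w + e.
  by split; apply/ler_addgt0Pr => e /near1 [].
move=> e0; have [N _ dN] : \forall m \near \oo, d m < e.
  by apply: (cvgr_lt 0 d0).
have := enorm_triangle (v N - w) w; have := enorm_triangle (w - v N) (v N).
rewrite !subrK v1 (enormBC w).
by have := vw N; have /= := dN N (leqnn N); split; lra.
Qed.

End Normals.

(** * Convergence of the hyperplanes and stability *)

Section Stability.
Variables (R : realType) (n : nat) (n_ge2 : (2 <= n)%N).
Variables (H : nat -> {vspace 'rV[R]_n}) (v : nat -> 'rV[R]_n).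
Hypothesis v1 : forall m, enorm (v m) = 1.
Hypothesis Hv : forall m, H m = orthc <[v m]>%VS.
Variable D : {vspace 'rV[R]_n} -> set 'rV[R]_n -> set 'rV[R]_n.
Hypothesis D_F : family_F D.
Variable d : nat -> R.
Hypothesis d0 : d @ \oo --> 0.
Hypothesis vd : forall m, enorm (v m - v m.+1) <= d m - d m.+1.

Lemma hyperplanes_cvg : hyperplane_cvg H.
Proof.
have [w vw] := cvg_of_summable_steps d0 vd.
have w1 := unit_of_limit v1 d0 vw.
exists (orthc <[w]>%VS); first exact: hyperplane_orthc_line.
apply: (@squeeze_cvgr _ _ _ _ (cst 0) (fun m => 2 * d m)).
- near=> m; rewrite grassmann_dist_ge0 Hv /=.
  by apply: le_trans (grassmann_dist_le (v1 m) w1) _; rewrite ler_wpM2l.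
- exact: cvg_cst.
- by rewrite -(mulr0 2); apply: cvgMr.
Unshelve. all: by end_near.
Qed.

Let proper_H m : proper_subspace (H m).
Proof.
rewrite /proper_subspace Hv hyperplane_orthc_line //.
by case: n n_ge2 => [//|[//|k]] _ /=; rewrite leqnn.
Qed.

Lemma iter_sym_body k j K : convex_body K ->
  convex_body (iter_sym D H k j K) /\
  symmetric_wrt (H (k + j)) (iter_sym D H k j K).
Proof.
move=> bodyK; have [DH _] := D_F.
elim: j => [|j [IH _]]; first by rewrite addn0; apply: DH.
exact: DH.
Qed.

(** Balls centred at the origin are symmetric, hence fixed, and monotonicity
    then keeps every iterate inside the ball. *)
Lemma iter_sym_sub_cball k j K r : 0 <= r -> convex_body K ->
  K `<=` cball r -> iter_sym D H k j K `<=` cball r.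
Proof.
move=> r0 bodyK Kr; have [_ DF] := D_F.
have bodyB := convex_body_cball n r0.
have step m L : convex_body L -> L `<=` cball r -> D (H m) L `<=` cball r.
  move=> bodyL Lr; have [mono _ inv] := DF _ (proper_H m).
  have <- : D (H m) (cball r) = cball r.
    by apply: inv => //; rewrite Hv; apply: symmetric_cball.
  exact: mono.
elim: j => [|j IH]; first exact: step.
by apply: step => //; have [] := iter_sym_body k j bodyK.
Qed.

Lemma summable_steps_stable : stable D H.
Proof.
move=> k K bodyK.
have [r r0 Kr] := body_sub_cball bodyK.
apply: (@almost_decreasing_body_cvg _ _ _ (fun j => 4 * r * d (k + j)%N)).
- by move=> j; have [] := iter_sym_body k j bodyK.
- move=> j; rewrite ler_wpM2l ?mulr_ge0 // -subr_ge0 addnS.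
  exact: le_trans (enorm_ge0 _) (vd _).
- rewrite -(mulr0 (4 * r)); apply: cvgMr.
  have -> : (fun j => d (k + j)%N) = (fun j => d (j + k)%N).
    by apply/funext => j; rewrite addnC.
  by rewrite (cvg_shiftn k d).
- move=> j x.
  have [bodyL symL] := iter_sym_body k j bodyK.
  have [_ DF] := D_F; have [mono _ inv] := DF _ (proper_H (k + j.+1)).
  rewrite Hv in symL; move: inv; rewrite {1}Hv => inv.
  move=> /(symmetrization_sub_thicken (v1 _) (v1 _) r0 mono inv bodyL symL
    (iter_sym_sub_cball r0 bodyK Kr))[y Ky xy].
  exists y => //; apply: le_trans xy _; rewrite -mulrBr addnS.
  by have := ler_wpM2r r0 (vd (k + j)); lra.
Qed.

End Stability.

Theorem theorem1p5 (R : realType) (n : nat) (n_ge2 : (2 <= n)%N)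
  (H : nat -> {vspace 'rV[R]_n}) (u : nat -> 'rV[R]_n)
  (H_hyperplane : forall m, hyperplane (H m))
  (u_unit : forall m, enorm (u m) = 1)
  (u_normal : forall m, H m = orthc <[u m]>%VS)
  (D : {vspace 'rV[R]_n} -> set 'rV[R]_n -> set 'rV[R]_n)
  (D_F : family_F D)
  (alpha : nat -> R)
  (alpha_range : forall m, (1 <= m)%N -> 0 <= alpha m <= pi / 2)
  (alpha_angle : forall m, (1 <= m)%N ->
     `|dotv (u m) (u m.-1)| = cos (alpha m))
  (alpha_summable : (\sum_(1 <= m <oo) `|alpha m|%:E < +oo)%E) :
  hyperplane_cvg H /\ stable D H.
Proof.
have [s s_aligned] := aligned_multiples u.
pose v m := s m *: u m.
have v1 m : enorm (v m) = 1.
  by rewrite enormZ u_unit mulr1; have [] := s_aligned m.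
have Hv m : H m = orthc <[v m]>%VS.
  rewrite orthc_lineZ //; have [sm _] := s_aligned m.
  by rewrite -normr_gt0 sm ltr01.
have [d d0 dE] := summable_tails (fun m => normr_ge0 (alpha m)) alpha_summable.
have vd m : enorm (v m - v m.+1) <= d m - d m.+1.
  have /andP[alpha0 _] := alpha_range m.+1 isT.
  rewrite dE ger0_norm // enormBC; apply: enorm_sub_le_angle => //.
  by rewrite -alpha_angle //; have [] := s_aligned m.
split; first exact: (hyperplanes_cvg v1 Hv d0 vd).
exact: (summable_steps_stable n_ge2 v1 Hv D_F d0 vd).
Qed.
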